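(* For the two-user BFIC with no CSIT with parameters $0\le p_d,p_c\le 1$ (model in the context), the capacity region $\mathcal{C}(p_d,p_c)$ is contained in $\bar{\mathcal{C}}(p_d,p_c)$, where: \begin{itemize} \item for $0 \le p_c \le \frac{p_d}{1+p_d}$: $\bar{\mathcal{C}}$ is the set of $(R_1,R_2)$ with $0\le R_i\le p_d$ for $i=1,2$ and $R_i + \beta R_{\bar i} \le \beta p_d + p_c - p_dp_c$ for $i=1,2$ ($\bar i=3-i$), where $\beta = \frac{p_d-p_c}{p_dp_c}$; \item for $\frac{p_d}{1+p_d}\le p_c\le p_d$: $\bar{\mathcal{C}}$ is the set of $(R_1,R_2)$ with $0\le R_i\le p_d$, $R_1+R_2\le 2p_c$, and $R_i + \frac{p_d}{p_c}R_{\bar i} \le \frac{p_d}{p_c}(p_d+p_c-p_dp_c)$ for $i=1,2$; \item for $p_d\le p_c\le 1$: $\bar{\mathcal{C}}$ is the set of $(R_1,R_2)$ with $0\le R_i\le p_d$ for $i=1,2$ and $R_1+R_2\le p_d+p_c-p_dp_c$. \end{itemize}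
   Context: Two-user BFIC: at each time $t$, transmitter ${\sf Tx}_i$ sends $X_i[t]\in\{0,1\}$ and receiver ${\sf Rx}_i$ receives $Y_i[t] = G_{ii}[t]X_i[t] \oplus G_{\bar i i}[t] X_{\bar i}[t]$, $i=1,2$, $\bar i = 3-i$, with arithmetic in $\mathbb{F}_2$. The channel gains $G_{ij}[t]\in\{0,1\}$ (from ${\sf Tx}_i$ to ${\sf Rx}_j$) are mutually independent Bernoulli random variables, independent over time, with $G_{ii}[t]\sim\mathcal{B}(p_d)$ and $G_{i\bar i}[t]\sim \mathcal{B}(p_c)$. ${\sf Tx}_i$ wishes to send a message $W_i$ uniform on $\{1,\dots,2^{nR_i}\}$ to ${\sf Rx}_i$ over $n$ channel uses; messages and channel gains are mutually independent. No CSIT: $X_i[t] = f_{i,t}(W_i)$. Receiver ${\sf Rx}_i$ decodes $\hat W_i = \varphi_i(Y_i^n, G_{ii}^n, G_{\bar i i}^n)$. A pair $(R_1,R_2)$ is achievable if there exist encoders/decoders with $\mathbb{E}[P(\hat W_i \ne W_i)]\to 0$ as $n\to\infty$ for $i=1,2$; $\mathcal{C}(p_d,p_c)$ is the closure of the set of achievable pairs. *)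

(* Defs.v *)
From Stdlib Require Import Reals.
From mathcomp Require Import all_boot all_order all_algebra.
From mathcomp Require Import Rstruct.

Set Implicit Arguments.
Unset Strict Implicit.
Unset Printing Implicit Defensive.

(* Channel state at one time instant: (G11, G12, G21, G22), where Gij is the
   gain from Tx_i to Rx_j. *)
Definition gain := (bool * bool * bool * bool)%type.
Definition g11 (g : gain) : bool := g.1.1.1.
Definition g12 (g : gain) : bool := g.1.1.2.
Definition g21 (g : gain) : bool := g.1.2.
Definition g22 (g : gain) : bool := g.2.

Definition bern (p : R) (b : bool) : R := if b then p else (1 - p)%R.

Definition gain_prob (pd pc : R) (g : gain) : R :=
  (bern pd (g11 g) * bern pc (g12 g) * bern pc (g21 g) * bern pd (g22 g))%R.

Definition gseq_prob (pd pc : R) (n : nat) (G : {ffun 'I_n -> gain}) : R :=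
  (\prod_(t < n) gain_prob pd pc (G t))%R.

Definition bseq n := {ffun 'I_n -> bool}.

(* A length-n code with message sets 'I_M1, 'I_M2 (no CSIT: codewords depend on
   the message only).  Rx1 decodes from (Y1^n, G11^n, G21^n), Rx2 from
   (Y2^n, G22^n, G12^n). *)
Record code (n M1 M2 : nat) := Code {
  enc1 : 'I_M1 -> bseq n;
  enc2 : 'I_M2 -> bseq n;
  dec1 : bseq n -> bseq n -> bseq n -> 'I_M1;
  dec2 : bseq n -> bseq n -> bseq n -> 'I_M2 }.

Definition out1 n (G : {ffun 'I_n -> gain}) (x1 x2 : bseq n) : bseq n :=
  [ffun t => addb (g11 (G t) && x1 t) (g21 (G t) && x2 t)].
Definition out2 n (G : {ffun 'I_n -> gain}) (x1 x2 : bseq n) : bseq n :=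
  [ffun t => addb (g22 (G t) && x2 t) (g12 (G t) && x1 t)].

Definition gproj n (f : gain -> bool) (G : {ffun 'I_n -> gain}) : bseq n :=
  [ffun t => f (G t)].

Definition ind (b : bool) : R := if b then 1%R else 0%R.

Definition err1 (pd pc : R) n M1 M2 (C : code n M1 M2) : R :=
  (\sum_(w1 : 'I_M1) \sum_(w2 : 'I_M2) \sum_(G : {ffun 'I_n -> gain})
     (INR M1 * INR M2)^-1 * gseq_prob pd pc G *
     ind (dec1 C (out1 G (enc1 C w1) (enc2 C w2)) (gproj g11 G) (gproj g21 G)
          != w1))%R.

Definition err2 (pd pc : R) n M1 M2 (C : code n M1 M2) : R :=
  (\sum_(w1 : 'I_M1) \sum_(w2 : 'I_M2) \sum_(G : {ffun 'I_n -> gain})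
     (INR M1 * INR M2)^-1 * gseq_prob pd pc G *
     ind (dec2 C (out2 G (enc1 C w1) (enc2 C w2)) (gproj g22 G) (gproj g12 G)
          != w2))%R.

(* M is the size of {1,...,2^{nR}}, read as the ceiling of 2^{nR}. *)
Definition msg_size (n : nat) (Rt : R) (M : nat) : Prop :=
  (INR M - 1 < Rpower 2 (INR n * Rt) <= INR M)%R.

Definition achievable (pd pc R1 R2 : R) : Prop :=
  (0 <= R1)%R /\ (0 <= R2)%R /\
  exists (M1 M2 : nat -> nat),
    (forall n, msg_size n R1 (M1 n) /\ msg_size n R2 (M2 n)) /\
    exists codes : forall n, code n (M1 n) (M2 n),
      forall eps : R, (0 < eps)%R -> exists N : nat, forall n : nat, (N <= n)%N ->
        (err1 pd pc (codes n) <= eps)%R /\ (err2 pd pc (codes n) <= eps)%R.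

Definition capacity_region (pd pc R1 R2 : R) : Prop :=
  forall eps : R, (0 < eps)%R -> exists a b : R,
    achievable pd pc a b /\ (Rabs (a - R1) < eps)%R /\ (Rabs (b - R2) < eps)%R.

Definition outer_bound (pd pc R1 R2 : R) : Prop :=
  let beta := ((pd - pc) / (pd * pc))%R in
  ((pc <= pd / (1 + pd))%R ->
     (0 <= R1 <= pd)%R /\ (0 <= R2 <= pd)%R /\
     ((0 < pc)%R ->
        (R1 + beta * R2 <= beta * pd + pc - pd * pc)%R /\
        (R2 + beta * R1 <= beta * pd + pc - pd * pc)%R)) /\
  ((pd / (1 + pd) <= pc <= pd)%R ->
     (0 <= R1 <= pd)%R /\ (0 <= R2 <= pd)%R /\ (R1 + R2 <= 2 * pc)%R /\
     ((0 < pc)%R ->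
        (R1 + pd / pc * R2 <= pd / pc * (pd + pc - pd * pc))%R /\
        (R2 + pd / pc * R1 <= pd / pc * (pd + pc - pd * pc))%R)) /\
  ((pd <= pc)%R ->
     (0 <= R1 <= pd)%R /\ (0 <= R2 <= pd)%R /\
     (R1 + R2 <= pd + pc - pd * pc)%R).

(* Main.v *)
(* For an input sequence [X] let [f p] be the mean entropy of [X] observed on a
   random set of instants, each taken independently with probability [p].  As
   entropy is submodular and a bit has entropy at most [ln 2], [f] vanishes at 0,
   is nondecreasing and concave, and has slope at most [n ln 2]: it satisfies the
   tangent inequality at every point.  Let [f] be the profile of a user's input
   and [g] that of the interfering one.  Fano's inequality bounds [r], the
   message entropy up to lower-order terms, in two ways:
     [r <= f pd]  and
     [r + g pc <= f (pd (1 - pc)) + n ln 2 pd pc + g (pc (1 - pd))],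
   the second by splitting the received entropy according to whether only the
   desired signal, both signals or only the interference is present.  All the
   faces of the outer bound are positive combinations of these two inequalities
   for both users with monotonicity, concavity and the slope bound; no further
   information-theoretic input is needed. *)

From mathcomp Require Import all_boot all_order all_algebra.
From mathcomp Require Import Rstruct.
Require Import Defs.
From Stdlib Require Import Reals.
From mathcomp Require Import ring lra.

Set Implicit Arguments.
Unset Strict Implicit.
Unset Printing Implicit Defensive.
Import Order.TTheory GRing.Theory Num.Theory.
Local Open Scope ring_scope.

(* [Reals] makes terms of type [R] be read in [R_scope]; here they are read in
   [ring_scope]. *)
Local Bind Scope ring_scope with R.
Local Arguments ln : clear scopes.

(** * Means of submodular functions over random masks *)

Definition bcons n (b : bool) (S : bseq n) : bseq n.+1 :=
  [ffun t => if unlift ord0 t is Some u then S u else b].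
Definition bempty n : bseq n := [ffun=> false].
Definition bunion n (S T : bseq n) : bseq n := [ffun t => S t || T t].
Definition binter n (S T : bseq n) : bseq n := [ffun t => S t && T t].
Definition bsub n (S T : bseq n) := forall t, S t -> T t.
Definition bcount n (S : bseq n) : R := (\sum_(t < n) S t)%:R.

Definition submodular n (h : bseq n -> R) :=
  forall S T, h (bunion S T) + h (binter S T) <= h S + h T.

Definition mask_mean n (p : R) (h : bseq n -> R) : R :=
  \sum_(S : bseq n) (\prod_(t < n) bern p (S t)) * h S.

(* The derivative of [mask_mean] in [p], computed coordinate by coordinate. *)
Fixpoint mask_slope (p : R) n : (bseq n -> R) -> R :=
  if n is m.+1 then fun h =>
    mask_mean p (h \o bcons true) - mask_mean p (h \o bcons false)
    + (p * mask_slope p (h \o bcons true)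
       + (1 - p) * mask_slope p (h \o bcons false))
  else fun=> 0.

Section BinarySequences.
Variable n : nat.
Implicit Types (b c : bool) (S T : bseq n).

Lemma bcons0 b S : bcons b S ord0 = b.
Proof. by rewrite ffunE unlift_none. Qed.

Lemma bconsS b S t : bcons b S (lift ord0 t) = S t.
Proof. by rewrite ffunE liftK. Qed.

Lemma bseqP (S T : bseq n.+1) :
  S ord0 = T ord0 -> (forall t, S (lift ord0 t) = T (lift ord0 t)) -> S = T.
Proof. by move=> e0 eS; apply/ffunP=> t; case: (unliftP ord0 t) => [u|] ->. Qed.

Lemma bcons_union b c S T :
  bunion (bcons b S) (bcons c T) = bcons (b || c) (bunion S T).
Proof. by apply: bseqP => [|t]; rewrite ffunE ?bcons0 ?bconsS // ffunE. Qed.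

Lemma bcons_inter b c S T :
  binter (bcons b S) (bcons c T) = bcons (b && c) (binter S T).
Proof. by apply: bseqP => [|t]; rewrite ffunE ?bcons0 ?bconsS // ffunE. Qed.

Lemma bcons_empty : bcons false (bempty n) = bempty n.+1.
Proof. by apply: bseqP => [|t]; rewrite ?bcons0 ?bconsS !ffunE. Qed.

Lemma bcons_sub b c S T : (b -> c) -> bsub S T -> bsub (bcons b S) (bcons c T).
Proof.
move=> bc ST t; case: (unliftP ord0 t) => [u|] ->; last by rewrite !bcons0.
by rewrite !bconsS; apply: ST.
Qed.

Lemma bcount_cons b S : bcount (bcons b S) = b%:R + bcount S.
Proof.
rewrite /bcount big_ord_recl bcons0 natrD; congr (_ + _%:R).
by apply: eq_bigr => t _; rewrite bconsS.
Qed.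

Lemma bsub_refl S : bsub S S. Proof. by []. Qed.

Lemma bunion_subr S T : bsub S T -> bunion S T = T.
Proof.
move=> ST; apply/ffunP => t; rewrite ffunE.
by case: (S t) (ST t) => // ->.
Qed.

Lemma binter_subl S T : bsub S T -> binter S T = S.
Proof.
move=> ST; apply/ffunP => t; rewrite ffunE.
by case: (S t) (ST t) => // ->.
Qed.

End BinarySequences.

Section MaskMean.
Variable p : R.

Lemma mask_mean0 (h : bseq 0 -> R) : mask_mean p h = h (bempty 0).
Proof.
rewrite /mask_mean (big_pred1 (bempty 0)) ?big_ord0 ?mul1r // => S.
by symmetry; apply/eqP/ffunP; case.
Qed.

Lemma mask_meanS n (h : bseq n.+1 -> R) :
  mask_mean p h =
  p * mask_mean p (h \o bcons true) + (1 - p) * mask_mean p (h \o bcons false).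
Proof.
pose unc (x : bool * bseq n) := bcons x.1 x.2.
pose cnu (S : bseq n.+1) : bool * bseq n := (S ord0, [ffun t => S (lift ord0 t)]).
have uncK : cancel unc cnu.
  move=> [b S]; rewrite /cnu /unc bcons0; congr (_, _).
  by apply/ffunP => t; rewrite ffunE bconsS.
have cnuK : cancel cnu unc.
  by move=> S; apply: bseqP => [|t]; rewrite ?bcons0 ?bconsS ?ffunE.
rewrite /mask_mean (reindex unc) /=; last by exists cnu => x _.
rewrite -(pair_bigA _ (fun b S =>
  (\prod_(t < n.+1) bern p (bcons b S t)) * h (bcons b S))).
rewrite big_bool !big_distrr /=; congr (_ + _); apply: eq_bigr => S _.
- rewrite big_ord_recl bcons0 mulrA; congr (_ * _ * _).
  by apply: eq_bigr => t _; rewrite bconsS.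
- rewrite big_ord_recl bcons0 mulrA; congr (_ * _ * _).
  by apply: eq_bigr => t _; rewrite bconsS.
Qed.

Lemma mask_mean_cst n c : mask_mean p (fun _ : bseq n => c) = c.
Proof.
elim: n => [|n IHn]; first by rewrite mask_mean0.
by rewrite mask_meanS /comp /= IHn -mulrDl addrC subrK mul1r.
Qed.

Lemma mask_meanD n (g h : bseq n -> R) :
  mask_mean p (fun S => g S + h S) = mask_mean p g + mask_mean p h.
Proof. by rewrite -big_split; apply: eq_bigr => S _; rewrite mulrDr. Qed.

Lemma mask_mean_count n : mask_mean p (@bcount n) = n%:R * p.
Proof.
elim: n => [|n IHn].
  by rewrite mask_mean0 mul0r /bcount big_ord0.
rewrite mask_meanS.
have E b : mask_mean p (@bcount n.+1 \o bcons b) = b%:R + n%:R * p.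
  rewrite -IHn -[X in X + _](mask_mean_cst n) -mask_meanD.
  by apply: eq_bigr => S _; rewrite /= bcount_cons.
by rewrite !E -natr1 mulr0n mulr1n; lra.
Qed.

Hypothesis p01 : 0 <= p <= 1.
Let p_ge0 : 0 <= p. Proof. by case/andP: p01. Qed.
Let onem_ge0 : 0 <= 1 - p. Proof. by rewrite subr_ge0; case/andP: p01. Qed.

Lemma mask_mean_le n (g h : bseq n -> R) :
  (forall S, g S <= h S) -> mask_mean p g <= mask_mean p h.
Proof.
move=> gh; apply: ler_sum => S _; apply: ler_wpM2l => //.
by apply: prodr_ge0 => t _; rewrite /bern; case: ifP.
Qed.

(** The slope is the sum over the instants of the mean increment caused by adding that instant to
    the mask. Bounds on increments therefore pass to slopes, here and in the next two lemmas. *)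
Lemma mask_slope_le n (g h : bseq n -> R) :
  (forall S T, bsub S T -> g T - g S <= h T - h S) ->
  mask_slope p g <= mask_slope p h.
Proof.
elim: n g h => [|n IHn] g h gh /=; first by [].
have IHb b : mask_slope p (g \o bcons b) <= mask_slope p (h \o bcons b).
  by apply: IHn => S T ST; apply: gh; apply: bcons_sub.
have: mask_mean p (fun S => g (bcons true S) + h (bcons false S))
   <= mask_mean p (fun S => g (bcons false S) + h (bcons true S)).
  apply: mask_mean_le => S.
  have := gh (bcons false S) (bcons true S)
    (bcons_sub (fun _ => isT) (@bsub_refl _ S)).
  lra.
rewrite !mask_meanD.
have := ler_wpM2l p_ge0 (IHb true).
have := ler_wpM2l onem_ge0 (IHb false).
rewrite /comp; lra.
Qed.

Lemma mask_slope_ge0 n (h : bseq n -> R) :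
  (forall S T, bsub S T -> h S <= h T) -> 0 <= mask_slope p h.
Proof.
elim: n h => [|n IHn] h hh /=; first by [].
have IHb b : 0 <= mask_slope p (h \o bcons b).
  by apply: IHn => S T ST; apply: hh; apply: bcons_sub.
have: mask_mean p (h \o bcons false) <= mask_mean p (h \o bcons true).
  by apply: mask_mean_le => S; apply: hh; apply: bcons_sub.
have := mulr_ge0 p_ge0 (IHb true).
have := mulr_ge0 onem_ge0 (IHb false).
lra.
Qed.

Lemma mask_slope_le_size n (h : bseq n -> R) c :
  (forall S T, bsub S T -> h T - h S <= c * (bcount T - bcount S)) ->
  mask_slope p h <= n%:R * c.
Proof.
elim: n h => [|n IHn] h hh /=; first by rewrite mul0r.
have IHb b : mask_slope p (h \o bcons b) <= n%:R * c.
  apply: IHn => S T ST /=.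
  have := hh _ _ (bcons_sub (fun bT : b => bT) ST).
  by rewrite !bcount_cons; lra.
have: mask_mean p (h \o bcons true) <= mask_mean p (fun S => c + h (bcons false S)).
  apply: mask_mean_le => S /=.
  have := hh (bcons false S) (bcons true S)
    (bcons_sub (fun _ => isT) (@bsub_refl _ S)).
  by rewrite !bcount_cons /= mulr1n mulr0n; lra.
rewrite mask_meanD mask_mean_cst -natr1 -/(h \o bcons false).
have := ler_wpM2l p_ge0 (IHb true).
have := ler_wpM2l onem_ge0 (IHb false).
lra.
Qed.

End MaskMean.

Lemma mask_mean_at0 n (h : bseq n -> R) : mask_mean 0 h = h (bempty n).
Proof.
elim: n h => [|n IHn] h; first by rewrite mask_mean0.
by rewrite mask_meanS mul0r add0r subr0 mul1r IHn /= bcons_empty.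
Qed.

(** Induction on the first instant. With [s1] and [s0] the slopes of [h] when this instant is in or
    out of the mask, the induction hypotheses leave a gap of exactly [(q - p)^2 * (s0 - s1)], which
    submodularity makes nonnegative. *)
Lemma mask_mean_tangent n (h : bseq n -> R) p q :
  0 <= p <= 1 -> 0 <= q <= 1 -> submodular h ->
  mask_mean q h <= mask_mean p h + (q - p) * mask_slope p h.
Proof.
move=> p01 q01.
have q_ge0 : 0 <= q by case/andP: q01.
have onemq_ge0 : 0 <= 1 - q by rewrite subr_ge0; case/andP: q01.
elim: n h => [|n IHn] h hsub.
  by rewrite !mask_mean0 mulr0 addr0.
have IHb b : mask_mean q (h \o bcons b)
    <= mask_mean p (h \o bcons b) + (q - p) * mask_slope p (h \o bcons b).
  apply: IHn => S T /=.
  by have := hsub (bcons b S) (bcons b T); rewrite bcons_union bcons_inter orbb andbb.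
(* Diminishing returns: submodularity at [bcons true S] and [bcons false T] with [S] inside [T]. *)
have slope_anti : mask_slope p (h \o bcons true) <= mask_slope p (h \o bcons false).
  apply: mask_slope_le => // S T ST /=.
  have := hsub (bcons true S) (bcons false T).
  by rewrite bcons_union bcons_inter /= bunion_subr // binter_subl //; lra.
rewrite !mask_meanS /=.
have := ler_wpM2l q_ge0 (IHb true).
have := ler_wpM2l onemq_ge0 (IHb false).
have := ler_wpM2l (sqr_ge0 (q - p)) slope_anti.
move: (mask_slope p (h \o bcons true)) (mask_slope p (h \o bcons false)) => s1 s0.
nra.
Qed.

(** * Concave profiles and rate bounds *)

(** [s p] is a supergradient of [f] at [p]. Its existence gives concavity, and its bounds 0 and [N]
    give monotonicity and the Lipschitz property, with no derivative involved. *)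
Definition concave_profile (N : R) (f : R -> R) :=
  f 0 = 0 /\ exists s : R -> R, forall p q, 0 <= p <= 1 -> 0 <= q <= 1 ->
    f q <= f p + (q - p) * s p /\ 0 <= s p <= N.

Lemma mask_mean_profile n (h : bseq n -> R) c :
  h (bempty n) = 0 -> (forall S T, bsub S T -> h S <= h T) ->
  (forall S T, bsub S T -> h T - h S <= c * (bcount T - bcount S)) ->
  submodular h -> concave_profile (n%:R * c) (fun p => mask_mean p h).
Proof.
move=> h0 hmono hlip hsub; split; first by rewrite mask_mean_at0.
exists (fun p => mask_slope p h) => p q p01 q01; split.
  exact: mask_mean_tangent.
by rewrite mask_slope_ge0 //= mask_slope_le_size.
Qed.

Section ConcaveProfile.
Variables (N : R) (f : R -> R).
Hypothesis fP : concave_profile N f.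

Lemma profile_mono p q : 0 <= p -> p <= q -> q <= 1 -> f p <= f q.
Proof.
move=> p0 pq q1; case: fP => _ [s sP].
have [||+ /andP[+ _]] := sP q p; [lra..|] => Hs s0.
have : 0 <= (q - p) * s q by apply: mulr_ge0; lra.
lra.
Qed.

Lemma profile_lipschitz p q :
  0 <= p -> p <= q -> q <= 1 -> f q <= f p + N * (q - p).
Proof.
move=> p0 pq q1; case: fP => _ [s sP].
have [||Hs /andP[_ sN]] := sP p q; [lra..|].
have : (q - p) * s p <= (q - p) * N by apply: ler_wpM2l => //; lra.
lra.
Qed.

Lemma profile_le p : 0 <= p <= 1 -> f p <= N * p.
Proof.
case/andP=> p0 p1; have := profile_lipschitz (lexx 0) p0 p1.
by case: fP => -> _; lra.
Qed.

(** The tangent at [b], evaluated at [a] and [c] with weights [c - b] and [b - a], so that the slope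
    cancels. *)
Lemma profile_chord a b c : 0 <= a -> a <= b -> b <= c -> c <= 1 ->
  (b - a) * (f c - f a) <= (c - a) * (f b - f a).
Proof.
move=> a0 ab bc c1; case: fP => _ [s sP].
have [||Ha _] := sP b a; [lra..|].
have [||Hc _] := sP b c; [lra..|].
have := ler_wpM2l (_ : 0 <= c - b) Ha => /(_ ltac:(lra)).
have := ler_wpM2l (_ : 0 <= b - a) Hc => /(_ ltac:(lra)).
lra.
Qed.

Lemma profile_ray p q : 0 <= p -> p <= q -> q <= 1 -> p * f q <= q * f p.
Proof.
move=> p0 pq q1; have := profile_chord (lexx 0) p0 pq q1.
by case: fP => -> _; lra.
Qed.

End ConcaveProfile.

(* [r] is the rate (times the blocklength) of the user whose input has the
   profile [f], when the interfering input has the profile [g]. *)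
Definition user_bound (pd pc N : R) (f g : R -> R) (r : R) :=
  r <= f pd /\
  r + g pc <= f (pd * (1 - pc)) + N * (pd * pc) + g (pc * (1 - pd)).

Section RateBounds.
Variables (pd pc N : R) (f1 f2 : R -> R) (r1 r2 : R).
Hypotheses (pd01 : 0 <= pd <= 1) (pc01 : 0 <= pc <= 1).
Hypotheses (f1P : concave_profile N f1) (f2P : concave_profile N f2).
Hypotheses (u1 : user_bound pd pc N f1 f2 r1).
Hypotheses (u2 : user_bound pd pc N f2 f1 r2).

Let pd_ge0 : 0 <= pd. Proof. by case/andP: pd01. Qed.
Let pd_le1 : pd <= 1. Proof. by case/andP: pd01. Qed.
Let pc_ge0 : 0 <= pc. Proof. by case/andP: pc01. Qed.
Let pc_le1 : pc <= 1. Proof. by case/andP: pc01. Qed.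
Let pcd_ge0 : 0 <= pc * pd. Proof. exact: mulr_ge0. Qed.
Let pc1d_ge0 : 0 <= pc * (1 - pd). Proof. by rewrite mulr_ge0 // subr_ge0. Qed.
Let pd1c_ge0 : 0 <= pd * (1 - pc). Proof. by rewrite mulr_ge0 // subr_ge0. Qed.
Let pc1d_01 : 0 <= pc * (1 - pd) <= 1. Proof. by move: pc1d_ge0 pcd_ge0 pc_le1; lra. Qed.
Let pd1c_01 : 0 <= pd * (1 - pc) <= 1. Proof. by move: pd1c_ge0 pcd_ge0 pd_le1; lra. Qed.

Lemma direct_bound : r1 <= N * pd.
Proof. by case: u1 => /le_trans-> //; apply: (profile_le f1P). Qed.

(** Here [r2 <= f2 pd <= f2 pc], and [f2 pc] is what the second bound of user 1 carries on its
    left. *)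
Lemma strong_sum_bound : pd <= pc -> r1 + r2 <= N * (pd + pc - pd * pc).
Proof.
move=> dc; case: u1 u2 => _ H1 [H2 _].
have := profile_mono f2P pd_ge0 dc pc_le1.
have := profile_le f1P pd1c_01.
have := profile_le f2P pc1d_01.
lra.
Qed.

(** Concavity from the origin gives [pc * f1 pd <= pd * f1 pc], so the direct bound on [r1] is
    absorbed by [f1 pc] in the second bound of user 2. *)
Lemma moderate_bound : pc <= pd ->
  pc * r1 + pd * r2 <= N * (pd * (pd + pc - pd * pc)).
Proof.
move=> cd; case: u1 u2 => H1 _ [_ H2].
have h2 : r2 + f1 pc <= N * (pd + pc - pd * pc).
  have := profile_le f1P pc1d_01; have := profile_le f2P pd1c_01; lra.
have := profile_ray f1P pc_ge0 cd pd_le1.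
have := ler_wpM2l pd_ge0 h2.
have := ler_wpM2l pc_ge0 H1.
lra.
Qed.

(** In the sum of the two second bounds, each profile at [pd * (1 - pc)] is dominated by its value
    at [pc] on the left. *)
Lemma moderate_sum_bound : pd * (1 - pc) <= pc -> r1 + r2 <= N * (2 * pc).
Proof.
move=> dc; case: u1 u2 => _ H1 [_ H2].
have := profile_mono f1P pd1c_ge0 dc pc_le1.
have := profile_mono f2P pd1c_ge0 dc pc_le1.
have := profile_le f1P pc1d_01.
have := profile_le f2P pc1d_01.
lra.
Qed.

(* The profile [f1] is compared at the three points
   [pc * (1 - pd) <= pc <= pd * (1 - pc)], whose gaps have ratio [1 / beta]. *)
Lemma weak_bound : pc <= pd * (1 - pc) ->
  pd * pc * r1 + (pd - pc) * r2
    <= N * ((pd - pc) * pd + pd * pc * (pc - pd * pc)).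
Proof.
move=> cd; case: u1 u2 => _ H1 [_ H2].
have {}H1 : r1 + f2 pc <= f1 (pd * (1 - pc)) + N * pc.
  by have := profile_le f2P pc1d_01; lra.
have dc_ge0 : 0 <= pd - pc by move: pcd_ge0; lra.
(* The weight left on [f2 pc] once the slope bound has moved [f2] from [pd * (1 - pc)] down to
   [pc]. *)
have slack_ge0 : 0 <= pd - pc - pc * pd by lra.
have := ler_wpM2l pcd_ge0 H1.
have := ler_wpM2l dc_ge0 H2.
have := ler_wpM2l dc_ge0 (profile_lipschitz f2P pc_ge0 cd (proj2 (andP pd1c_01))).
have := ler_wpM2l slack_ge0 (profile_le f2P pc01).
have := ler_wpM2l pcd_ge0 (profile_le f1P pc1d_01).
have le_a_pc : pc * (1 - pd) <= pc by move: pcd_ge0; lra.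
have := profile_chord f1P pc1d_ge0 le_a_pc cd (proj2 (andP pd1c_01)).
lra.
Qed.

End RateBounds.

(** * Entropy under a uniform law *)

(** This stands in for Jensen's inequality: the cardinality bound, submodularity and Fano's
    inequality each sum it over the sample space. *)
Lemma ln_le_subr1 (x : R) : 0 < x -> ln x <= x - 1.
Proof.
move=> /RltP x0; have /RleP := exp_ineq1_le (ln x).
by rewrite exp_ln // RplusE R1E; lra.
Qed.

Lemma lnM (x y : R) : 0 < x -> 0 < y -> ln (x * y) = ln x + ln y.
Proof. by move=> /RltP x0 /RltP y0; apply: ln_mult. Qed.

Lemma lnV (x : R) : 0 < x -> ln x^-1 = - ln x.
Proof. by move=> /RltP x0; apply: ln_Rinv. Qed.

Lemma ler_ln (x y : R) : 0 < x -> x <= y -> ln x <= ln y.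
Proof.
move=> x0; rewrite le_eqVlt => /predU1P[-> //|xy].
by apply/RleP/Rlt_le/ln_increasing; apply/RltP.
Qed.

Lemma ln2_gt0 : 0 < ln 2%:R.
Proof.
have -> : 0 = ln 1 :> R by rewrite -R1E ln_1.
by apply/RltP/ln_increasing; apply/RltP; rewrite ?ltr01 ?ltr1n.
Qed.

(** Divided by [#|Om|], this is the probability of the value [phi w]; it lets sums over values be
    written as sums over outcomes. *)
Definition fiber (Om : finType) (T : eqType) (phi : Om -> T) (w : Om) : R :=
  #|[pred v | phi v == phi w]|%:R.

(* The Shannon entropy, in nats, of [phi] under the uniform law on [Om]. *)
Definition entropy (Om : finType) (T : eqType) (phi : Om -> T) : R :=
  ln #|Om|%:R - (\sum_w ln (fiber phi w)) / #|Om|%:R.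

Section Entropy.
Variable Om : finType.

Lemma sum_cst (c : R) : \sum_(w : Om) c = #|Om|%:R * c.
Proof. by rewrite sumr_const mulr_natl. Qed.

Lemma fiber_gt0 (T : eqType) (phi : Om -> T) w : 0 < fiber phi w.
Proof. by rewrite ltr0n; apply/card_gt0P; exists w; rewrite inE. Qed.

Lemma eq_fiber (T : eqType) (phi : Om -> T) u v :
  phi u = phi v -> fiber phi u = fiber phi v.
Proof. by rewrite /fiber => ->. Qed.

Lemma fiberE (T : eqType) (phi : Om -> T) w :
  fiber phi w = \sum_v (phi v == phi w)%:R.
Proof.
rewrite /fiber -sum1_card natr_sum big_mkcond; apply: eq_bigr => v _.
by rewrite inE; case: eqP.
Qed.

Lemma fiber_le_fun (T U : eqType) (phi : Om -> T) (psi : Om -> U) w :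
  (forall u v, psi u = psi v -> phi u = phi v) -> fiber psi w <= fiber phi w.
Proof.
move=> H; rewrite ler_nat; apply: subset_leq_card; apply/subsetP => v.
by rewrite !inE => /eqP/H->.
Qed.

Lemma entropy_le_fun (T U : eqType) (phi : Om -> T) (psi : Om -> U) :
  (forall u v, psi u = psi v -> phi u = phi v) -> entropy phi <= entropy psi.
Proof.
move=> H; rewrite lerD2l lerN2; apply: ler_wpM2r; first by rewrite invr_ge0 ler0n.
apply: ler_sum => w _; apply: ler_ln; [exact: fiber_gt0 | exact: fiber_le_fun].
Qed.

Lemma eq_entropy (T : eqType) (phi psi : Om -> T) :
  phi =1 psi -> entropy phi = entropy psi.
Proof.
by move=> E; apply/le_anti/andP; split; apply: entropy_le_fun => u v; rewrite !E.
Qed.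

(** Each value [a] is shared by a whole fibre, so dividing by the fibre size counts [F a] at most
    once. *)
Lemma sum_fiber_le (T : finType) (phi : Om -> T) (P : pred Om) (A : {pred T})
    (F : T -> R) :
  (forall a, 0 <= F a) -> (forall w, P w -> phi w \in A) ->
  \sum_(w | P w) F (phi w) / fiber phi w <= \sum_(a in A) F a.
Proof.
move=> F0 PA; rewrite (partition_big phi (mem A)) //=; apply: ler_sum => a _.
have [/existsP[u /eqP ua]|] := boolP [exists u, phi u == a]; last first.
  rewrite negb_exists => /forallP na; rewrite big_pred0 // => w.
  by rewrite (negbTE (na w)) andbF.
apply: (@le_trans _ _ (\sum_(w | phi w == a) F a / fiber phi u)).
  rewrite [X in _ <= X](bigID P) /=.
  rewrite (eq_bigl (fun w => (phi w == a) && P w)); last by move=> w; rewrite andbC.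
  rewrite (eq_bigr (fun=> F a / fiber phi u)); last first.
    by move=> w /andP[/eqP wa _]; rewrite wa (@eq_fiber _ _ w u) ?wa.
  rewrite lerDl; by apply: sumr_ge0 => w _; apply: divr_ge0.
rewrite sumr_const -mulr_natr.
have -> : #|[pred w | phi w == a]|%:R = fiber phi u by rewrite /fiber ua.
by rewrite divfK ?gt_eqF ?fiber_gt0.
Qed.

Lemma entropy_le_card (T : finType) (phi : Om -> T) (A : {pred T}) :
  (0 < #|Om|)%nat -> (forall w, phi w \in A) -> entropy phi <= ln #|A|%:R.
Proof.
move=> Om0 phiA.
have A0 : (0 < #|A|)%nat.
  by have /card_gt0P[w _] := Om0; apply/card_gt0P; exists (phi w).
have Om0' : 0 < #|Om|%:R :> R by rewrite ltr0n.
have A0' : 0 < #|A|%:R :> R by rewrite ltr0n.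
have sumP : \sum_w (fiber phi w)^-1 <= #|A|%:R.
  have := @sum_fiber_le _ phi predT A (fun=> 1) (fun=> ler01) (fun w _ => phiA w).
  by rewrite sumr_const; under eq_bigr do rewrite mul1r.
have : \sum_w (ln #|Om|%:R - ln (fiber phi w) - ln #|A|%:R)
    <= \sum_w (#|Om|%:R / #|A|%:R * (fiber phi w)^-1 - 1).
  apply: ler_sum => w _; have f0 := fiber_gt0 phi w.
  rewrite addrAC -lnV // -lnM ?invr_gt0 // -lnV // -lnM ?mulr_gt0 ?invr_gt0 //.
  by apply: ln_le_subr1; rewrite ?mulr_gt0 ?invr_gt0.
rewrite !sumrB -big_distrr /= !sum_cst mulr1 => le1.
have le2 : #|Om|%:R / #|A|%:R * (\sum_w (fiber phi w)^-1) <= #|Om|%:R :> R.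
  by rewrite mulrAC ler_pdivrMr //; apply: ler_wpM2l => //; apply: ltW.
rewrite /entropy lerBlDr -lerBlDl ler_pdivlMr // mulrC mulrBr; lra.
Qed.

(** Conditional mutual information is nonnegative: the law of [(al, be)] is compared with the one
    that makes [al] and [be] independent given [ga]. The summand of [sumP] is the ratio of the two
    laws. *)
Lemma entropy_submod (T1 T2 : finType) (T3 T4 : eqType)
    (al : Om -> T1) (be : Om -> T2) (ga : Om -> T3) (de : Om -> T4) :
  (forall u v, al u = al v -> be u = be v -> de u = de v) ->
  (forall u v, al u = al v -> ga u = ga v) ->
  (forall u v, be u = be v -> ga u = ga v) ->
  entropy de + entropy ga <= entropy al + entropy be.
Proof.
move=> abd ag bg.
pose ab w := (al w, be w).
suff: entropy ab + entropy ga <= entropy al + entropy be.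
  apply: le_trans; rewrite lerD2r; apply: entropy_le_fun => u v [].
  exact: abd.
have sumP : \sum_w fiber al w * fiber be w / (fiber ab w * fiber ga w)
    <= #|Om|%:R.
  (* The fibres of [al] and [be] are expanded over [u] and [v]. An outcome [w] matching both exists
     only if [ga u = ga v], which leaves one fibre of [ga] for each [u]. *)
  have -> : \sum_w fiber al w * fiber be w / (fiber ab w * fiber ga w) =
     \sum_u \sum_v (fiber ga u)^-1 *
        \sum_(w | ab w == (al u, be v)) 1 / fiber ab w.
    under eq_bigr => w _.
      rewrite [fiber al w]fiberE [fiber be w]fiberE mulrC big_distrlr big_distrr /=.
      under eq_bigr do rewrite big_distrr /=.
      over.
    rewrite exchange_big; apply: eq_bigr => u _.
    rewrite exchange_big; apply: eq_bigr => v _.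
    rewrite big_distrr [RHS]big_mkcond /=; apply: eq_bigr => w _.
    rewrite xpair_eqE [al w == _]eq_sym [be w == _]eq_sym.
    case: (al u =P al w) => [/ag/eq_fiber<-|_] /=; last by rewrite mul0r mulr0.
    case: (be v =P be w) => [_|_] /=; last by rewrite !mulr0.
    by rewrite !mulr1 invfM mul1r mulrC.
  have le1 u v : \sum_(w | ab w == (al u, be v)) 1 / fiber ab w
      <= (ga v == ga u)%:R.
    have [uv|uv] := eqVneq (ga v) (ga u).
      apply: (le_trans (@sum_fiber_le _ ab _ (pred1 (al u, be v)) (fun=> 1) _ _)) => //.
      by rewrite big_pred1_eq.
    rewrite big_pred0 // => w; apply/negP; rewrite xpair_eqE.
    case/andP=> /eqP/ag wu /eqP/bg wv.
    by rewrite -wu -wv eqxx in uv.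
  apply: (@le_trans _ _ (\sum_u \sum_v (fiber ga u)^-1 * (ga v == ga u)%:R)).
    apply: ler_sum => u _; apply: ler_sum => v _; apply: ler_wpM2l => //.
    by rewrite invr_ge0 ltW ?fiber_gt0.
  under eq_bigr => u _.
    rewrite -big_distrr -fiberE /= mulVf ?gt_eqF ?fiber_gt0 //.
    over.
  by rewrite sum_cst mulr1.
have : \sum_w (ln (fiber al w) + ln (fiber be w)
              - (ln (fiber ab w) + ln (fiber ga w)))
    <= \sum_w (fiber al w * fiber be w / (fiber ab w * fiber ga w) - 1).
  apply: ler_sum => w _.
  have ha := fiber_gt0 al w; have hb := fiber_gt0 be w.
  have hab := fiber_gt0 ab w; have hg := fiber_gt0 ga w.
  rewrite -!lnM // -lnV ?mulr_gt0 // -lnM ?mulr_gt0 ?invr_gt0 ?mulr_gt0 //.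
  by apply: ln_le_subr1; rewrite ?mulr_gt0 ?invr_gt0 ?mulr_gt0.
rewrite !sumrB !big_split /= sum_cst mulr1 => le1.
have {}le1 : \sum_w ln (fiber al w) + \sum_w ln (fiber be w)
   <= \sum_w ln (fiber ab w) + \sum_w ln (fiber ga w) by lra.
have : (\sum_w ln (fiber al w) + \sum_w ln (fiber be w)) / #|Om|%:R
   <= (\sum_w ln (fiber ab w) + \sum_w ln (fiber ga w)) / #|Om|%:R.
  by apply: ler_wpM2r => //; rewrite invr_ge0 ler0n.
rewrite !mulrDl /entropy; lra.
Qed.

Lemma entropy_cst (T : eqType) (c : T) : entropy (fun _ : Om => c) = 0.
Proof.
rewrite /entropy /fiber.
under eq_bigr do rewrite (eq_card (_ : _ =i Om)) ?inE ?eqxx //.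
rewrite sum_cst mulrAC.
have [->|Om0] := posnP #|Om|; last by rewrite divff ?mul1r ?subrr // pnatr_eq0 -lt0n.
rewrite mul0r mul0r subr0.
(* On an empty sample space the claim is [ln 0 = 0], the default value of [ln]. *)
by rewrite /ln; case: Rlt_dec => // H; move/RltP: (H); rewrite ltxx.
Qed.

Lemma entropy_inj (T : eqType) (phi : Om -> T) :
  injective phi -> entropy phi = ln #|Om|%:R.
Proof.
move=> phi_inj; rewrite /entropy big1 ?mul0r ?subr0 // => w _.
rewrite /fiber (eq_card (_ : _ =i pred1 w)) ?card1 ?ln_1 // => v.
by rewrite !inE (inj_eq phi_inj).
Qed.

(** The law of [(W, Y)] is compared with that of [Y] followed by a guess of weight [c]. The additive
    1 is the total weight 2 less the 1 in [ln x <= x - 1]. *)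
Lemma fano (T U : finType) (W : Om -> T) (Y : Om -> U) (d : U -> T) :
  (0 < #|Om|)%nat ->
  entropy (fun w => (W w, Y w)) <=
  entropy Y + 1 + #|[pred w | d (Y w) != W w]|%:R / #|Om|%:R * ln #|T|%:R.
Proof.
move=> Om0; set B := [pred w | _]; pose WY w := (W w, Y w).
have T0 : (0 < #|T|)%nat by have /card_gt0P[w _] := Om0; apply/card_gt0P; exists (W w).
have Om0' : 0 < #|Om|%:R :> R by rewrite ltr0n.
have T0' : 0 < #|T|%:R :> R by rewrite ltr0n.
(* [c] weighs the message guessed from [y] by 1 and every other one by
   [1 / #|T|], so that the weights add up to at most 2 for each [y]. *)
pose c (x : T * U) : R := if d x.2 == x.1 then 1 else #|T|%:R^-1.
have c0 x : 0 <= c x by rewrite /c; case: ifP => _ //; rewrite invr_ge0 ltW.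
have sumc y : \sum_(x | x.2 == y) c x <= 2.
  rewrite (reindex_onto (fun t => (t, y)) fst) /=; last first.
    by move=> [t z] /= /eqP ->.
  rewrite (eq_bigl xpredT) => [|t]; last by rewrite !eqxx.
  rewrite (bigD1 (d y)) //= {1}/c /= eqxx.
  have -> : 2 = 1 + #|T|%:R * #|T|%:R^-1 :> R by rewrite divff ?gt_eqF.
  rewrite lerD2l mulr_natl -sumr_const [X in _ <= X](bigD1 (d y)) //=.
  rewrite (eq_bigr (fun=> #|T|%:R^-1)) => [|t td]; last first.
    by rewrite /c /= eq_sym (negbTE td).
  by rewrite lerDr invr_ge0 ltW.
have sumP : \sum_w fiber Y w * (c (WY w) / fiber WY w) <= 2 * #|Om|%:R.
  have -> : \sum_w fiber Y w * (c (WY w) / fiber WY w) =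
      \sum_u \sum_(w | Y w == Y u) c (WY w) / fiber WY w.
    under eq_bigr do rewrite fiberE big_distrl /=.
    rewrite exchange_big; apply: eq_bigr => u _.
    rewrite [RHS]big_mkcond; apply: eq_bigr => w _.
    by rewrite eq_sym; case: eqP; rewrite ?mul1r ?mul0r.
  rewrite mulrC -sum_cst; apply: ler_sum => u _.
  apply: le_trans (sumc (Y u)).
  by apply: (@sum_fiber_le _ WY _ [pred x | x.2 == Y u]).
have lnc w : ln (c (WY w)) = - ((w \in B)%:R * ln #|T|%:R).
  rewrite /c inE /=; case: eqP => _ /=; first by rewrite ln_1 mul0r oppr0.
  by rewrite lnV // mul1r.
have : \sum_w (ln (fiber Y w) - ln (fiber WY w) - (w \in B)%:R * ln #|T|%:R)
    <= \sum_w (fiber Y w * (c (WY w) / fiber WY w) - 1).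
  apply: ler_sum => w _.
  have hY := fiber_gt0 Y w; have hWY := fiber_gt0 WY w.
  have hc : 0 < c (WY w) by rewrite /c; case: ifP => _ //; rewrite invr_gt0.
  rewrite -lnc -lnV // -!lnM ?mulr_gt0 ?invr_gt0 // -mulrA [_^-1 * _]mulrC.
  by apply: ln_le_subr1; rewrite ?mulr_gt0 ?invr_gt0.
rewrite !sumrB -big_distrl /= sum_cst mulr1 => le1.
have sumB : \sum_w (w \in B)%:R = #|B|%:R :> R.
  rewrite -sum1_card natr_sum [RHS]big_mkcond.
  by apply: eq_bigr => w _; case: (w \in B).
rewrite sumB in le1.
have : (\sum_w ln (fiber Y w) - \sum_w ln (fiber WY w) - #|B|%:R * ln #|T|%:R)
     / #|Om|%:R <= 1.
  by rewrite ler_pdivrMr //; lra.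
rewrite !mulrBl /entropy -/WY mulrAC; lra.
Qed.

End Entropy.

Lemma entropy_prod (Om1 Om2 : finType) (T1 T2 : eqType)
    (phi : Om1 -> T1) (psi : Om2 -> T2) :
  (0 < #|Om1|)%nat -> (0 < #|Om2|)%nat ->
  entropy (fun w : Om1 * Om2 => (phi w.1, psi w.2)) = entropy phi + entropy psi.
Proof.
move=> n1 n2; have n1' : 0 < #|Om1|%:R :> R by rewrite ltr0n.
have n2' : 0 < #|Om2|%:R :> R by rewrite ltr0n.
rewrite /entropy card_prod natrM lnM //.
have -> : \sum_w ln (fiber (fun w : Om1 * Om2 => (phi w.1, psi w.2)) w)
  = \sum_u \sum_v (ln (fiber phi u) + ln (fiber psi v)).
  rewrite pair_bigA; apply: eq_bigr => -[u v] _ /=.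
  rewrite -lnM ?fiber_gt0 //; congr ln; rewrite /fiber -natrM -cardX /=.
  by congr (_%:R); apply: eq_card => -[a b]; rewrite !inE.
under eq_bigr do rewrite big_split sum_cst /=.
rewrite big_split sum_cst /= -big_distrr /=.
field.
by rewrite !gt_eqF.
Qed.

Lemma entropy_fst (Om1 Om2 : finType) (T : eqType) (phi : Om1 -> T) :
  (0 < #|Om1|)%nat -> (0 < #|Om2|)%nat ->
  entropy (fun w : Om1 * Om2 => phi w.1) = entropy phi.
Proof.
move=> n1 n2; have := entropy_prod phi (fun _ : Om2 => tt) n1 n2.
rewrite entropy_cst addr0 => <-.
by apply/le_anti/andP; split; apply: entropy_le_fun => -[u v] [u' v'] /=;
  [case | move=> ->].
Qed.

Lemma entropy_snd (Om1 Om2 : finType) (T : eqType) (phi : Om2 -> T) :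
  (0 < #|Om1|)%nat -> (0 < #|Om2|)%nat ->
  entropy (fun w : Om1 * Om2 => phi w.2) = entropy phi.
Proof.
move=> n1 n2; have := entropy_prod (fun _ : Om1 => tt) phi n1 n2.
rewrite entropy_cst add0r => <-.
by apply/le_anti/andP; split; apply: entropy_le_fun => -[u v] [u' v'] /=;
  [case | move=> ->].
Qed.

(** * The interference channel *)

Definition bdiff n (S T : bseq n) : bseq n := [ffun t => S t && ~~ T t].

(** Instants outside [S] are erased to [false] rather than dropped, so that all observations share
    one type. *)
Definition masked_entropy n (Om : finType) (X : Om -> bseq n) (S : bseq n) : R :=
  entropy (fun w => binter S (X w)).

Section MaskedEntropy.
Variables (n : nat) (Om : finType) (X : Om -> bseq n).
Implicit Types S T : bseq n.

Lemma binter_bsub S T x y : bsub S T -> binter T x = binter T y ->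
  binter S x = binter S y :> bseq n.
Proof.
move=> ST /ffunP xy; apply/ffunP => t; move: (xy t) (ST t); rewrite !ffunE.
by case: (S t) => //= xyt /(_ isT) Tt; rewrite Tt in xyt.
Qed.

Lemma masked_entropy_mono S T :
  bsub S T -> masked_entropy X S <= masked_entropy X T.
Proof. by move=> ST; apply: entropy_le_fun => u v; apply: binter_bsub. Qed.

Lemma masked_entropy_empty : masked_entropy X (bempty n) = 0.
Proof.
rewrite -(entropy_cst Om (bempty n)); apply/le_anti/andP; split;
  apply: entropy_le_fun => // u v _; by apply/ffunP => t; rewrite !ffunE.
Qed.

Lemma masked_entropy_submodular : submodular (masked_entropy X).
Proof.
move=> S T; apply: entropy_submod => u v.
- move=> /ffunP uS /ffunP uT; apply/ffunP => t.
  by move: (uS t) (uT t); rewrite !ffunE; case: (S t); case: (T t).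
- by apply: binter_bsub => t; rewrite ffunE => /andP[].
- by apply: binter_bsub => t; rewrite ffunE => /andP[].
Qed.

Lemma masked_entropy_union S T : masked_entropy X (bunion S T)
  <= masked_entropy X S + masked_entropy X T.
Proof.
have := masked_entropy_submodular S T.
have : masked_entropy X (bempty n) <= masked_entropy X (binter S T).
  by apply: masked_entropy_mono => t; rewrite ffunE.
rewrite masked_entropy_empty; lra.
Qed.

Hypothesis Om_gt0 : (0 < #|Om|)%nat.

Lemma masked_entropy_le_count S : masked_entropy X S <= ln 2%:R * bcount S.
Proof.
pose D := [pred t | S t].
(* The masked inputs lie among the sequences that vanish outside [S]. *)
have -> : ln 2%:R * bcount S = ln #|pffun_on false D (@predT bool)|%:R.
  rewrite card_pffun_on card_bool /bcount.
  have -> : (\sum_(t < n) S t = #|D|)%nat.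
    rewrite -sum1_card [RHS]big_mkcond; apply: eq_bigr => t _.
    by rewrite inE /=; case: (S t).
  elim: #|D| => [|k IHk]; first by rewrite mulr0 ln_1.
  rewrite expnS natrM lnM ?ltr0n ?expn_gt0 // -IHk -natr1; lra.
apply: entropy_le_card => // w; apply/pffun_onP; split=> [|t //].
by apply/subsetP => t; rewrite !inE ffunE; case: (S t).
Qed.

Lemma masked_entropy_lipschitz S T : bsub S T ->
  masked_entropy X T - masked_entropy X S <= ln 2%:R * (bcount T - bcount S).
Proof.
move=> ST.
have TE : T = bunion S (bdiff T S).
  by apply/ffunP => t; rewrite !ffunE; case: (S t) (ST t) => [->|_] //=; rewrite andbT.
have cE : bcount T = bcount S + bcount (bdiff T S).
  rewrite {1}TE /bcount -natrD -big_split; congr (_%:R).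
  by apply: eq_bigr => t _; rewrite !ffunE; case: (S t); case: (T t).
have := masked_entropy_union S (bdiff T S); rewrite -TE.
have := masked_entropy_le_count (bdiff T S).
rewrite cE; lra.
Qed.

Lemma masked_entropy_profile : concave_profile (n%:R * ln 2%:R)
  (fun p => mask_mean p (masked_entropy X)).
Proof.
apply: mask_mean_profile; first exact: masked_entropy_empty.
- exact: masked_entropy_mono.
- exact: masked_entropy_lipschitz.
- exact: masked_entropy_submodular.
Qed.

End MaskedEntropy.

(* [S] and [T] are the direct and the cross gains, [x] and [y] the desired and
   the interfering inputs. *)
Definition receive n (S T x y : bseq n) : bseq n :=
  [ffun t => addb (S t && x t) (T t && y t)].

Section FixedGains.
Variables (n : nat) (W W' : finType) (X : W -> bseq n) (X' : W' -> bseq n).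
Variables S T : bseq n.
Hypotheses (W_gt0 : (0 < #|W|)%nat) (W'_gt0 : (0 < #|W'|)%nat).

Let Y (w : W * W') := receive S T (X w.1) (X' w.2).

Lemma entropy_receive_le_add :
  entropy Y <= masked_entropy X S + masked_entropy X' T.
Proof.
rewrite -entropy_prod //; apply: entropy_le_fun => u v [] /ffunP uS /ffunP uT.
apply/ffunP => t; move: (uS t) (uT t); rewrite !ffunE.
by move=> -> ->.
Qed.

(* The instants are split into those with only the desired signal, those with a
   collision and those with only interference. *)
Lemma entropy_receive_le_split :
  entropy Y <= masked_entropy X (bdiff S T) + ln 2%:R * bcount (binter S T)
               + masked_entropy X' (bdiff T S).
Proof.
have WW'_gt0 : (0 < #|{: W * W'}|)%nat by rewrite card_prod muln_gt0 W_gt0.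
have XE : masked_entropy X (bdiff S T) = masked_entropy Y (bdiff S T).
  rewrite /masked_entropy -(entropy_fst _ W_gt0 W'_gt0).
  apply: eq_entropy => w; apply/ffunP => t; rewrite !ffunE.
  by case: (S t); case: (T t); rewrite //= addbF.
have X'E : masked_entropy X' (bdiff T S) = masked_entropy Y (bdiff T S).
  rewrite /masked_entropy -(entropy_snd _ W_gt0 W'_gt0).
  apply: eq_entropy => w; apply/ffunP => t; rewrite !ffunE.
  by case: (S t); case: (T t).
have YE : entropy Y
    = masked_entropy Y (bunion (bunion (bdiff S T) (binter S T)) (bdiff T S)).
  apply: eq_entropy => w; apply/ffunP => t; rewrite !ffunE.
  by case: (S t); case: (T t).
rewrite XE X'E YE.
apply: (le_trans (masked_entropy_union _ _ _)); rewrite lerD2r.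
apply: (le_trans (masked_entropy_union _ _ _)); rewrite lerD2l.
exact: masked_entropy_le_count.
Qed.

(* Given its own message, a receiver learns exactly the interference on [T]. *)
Lemma entropy_message_receive :
  entropy (fun w => (w.1, Y w)) = ln #|W|%:R + masked_entropy X' T.
Proof.
rewrite -(entropy_inj (phi := @idfun W)) // -entropy_prod //.
apply/le_anti/andP; split; apply: entropy_le_fun => -[u u'] [v v'] /= [-> /ffunP E];
  congr (_, _); apply/ffunP => t; move: (E t); rewrite !ffunE; first by move=> ->.
by move/addbI.
Qed.

Variable d : bseq n -> W.

Let Pe : R := #|[pred w | d (Y w) != w.1]|%:R / #|{: W * W'}|%:R.

(** Fano's inequality bounds the entropy of message and output; the interference term
    [masked_entropy X' T] appears on both sides and cancels. The next lemma keeps it, using the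
    finer bound on the output. *)
Lemma rate_receive_le_direct :
  (1 - Pe) * ln #|W|%:R - 1 <= masked_entropy X S.
Proof.
have := fano (fst : W * W' -> W) Y d.
rewrite card_prod muln_gt0 W_gt0 W'_gt0 -card_prod => /(_ isT).
have := entropy_receive_le_add; have := entropy_message_receive.
rewrite -/Pe => ->; lra.
Qed.

Lemma rate_receive_le_split :
  (1 - Pe) * ln #|W|%:R - 1 + masked_entropy X' T <=
  masked_entropy X (bdiff S T) + ln 2%:R * bcount (binter S T)
  + masked_entropy X' (bdiff T S).
Proof.
have := fano (fst : W * W' -> W) Y d.
rewrite card_prod muln_gt0 W_gt0 W'_gt0 -card_prod => /(_ isT).
have := entropy_receive_le_split; have := entropy_message_receive.
rewrite -/Pe => ->; lra.
Qed.

End FixedGains.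

(** * Averaging over the channel gains *)

Section GainMean.
Variables (pd pc : R) (n : nat).

Definition gain_mean (F : {ffun 'I_n -> gain} -> R) : R :=
  \sum_G gseq_prob pd pc G * F G.

Lemma gain_meanD F1 F2 :
  gain_mean (fun G => F1 G + F2 G) = gain_mean F1 + gain_mean F2.
Proof. by rewrite -big_split; apply: eq_bigr => G _; rewrite mulrDr. Qed.

Lemma gain_meanZ c F : gain_mean (fun G => c * F G) = c * gain_mean F.
Proof. by rewrite big_distrr; apply: eq_bigr => G _ /=; rewrite mulrCA. Qed.

Hypotheses (pd01 : 0 <= pd <= 1) (pc01 : 0 <= pc <= 1).

Lemma gain_mean_le F1 F2 :
  (forall G, F1 G <= F2 G) -> gain_mean F1 <= gain_mean F2.
Proof.
have bern_ge0 p b : 0 <= p <= 1 -> 0 <= bern p b.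
  by case/andP=> p0 p1; rewrite /bern; case: b; rewrite ?subr_ge0.
move=> F12; apply: ler_sum => G _; apply: ler_wpM2l => //.
by apply: prodr_ge0 => t _; rewrite !mulr_ge0 ?bern_ge0.
Qed.

Hypothesis gain_prob1 : \sum_g gain_prob pd pc g = 1.

(** The gains are independent over time, so the instants where [phi] holds form a random mask of
    parameter [p]. *)
Lemma gain_mean_proj (phi : gain -> bool) p (h : bseq n -> R) :
  \sum_g gain_prob pd pc g * (phi g)%:R = p ->
  gain_mean (fun G => h (gproj phi G)) = mask_mean p h.
Proof.
move=> phi_p.
have phi_bern b : \sum_(g | phi g == b) gain_prob pd pc g = bern p b.
  have trueE : \sum_(g | phi g) gain_prob pd pc g = p.
    rewrite -phi_p big_mkcond; apply: eq_bigr => g _.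
    by case: (phi g); rewrite ?mulr1 ?mulr0.
  case: b; first by rewrite -trueE; apply: eq_bigl => g; rewrite eqb_id.
  move: (gain_prob1); rewrite (bigID phi) /=   trueE /bern => <-.
  by rewrite addrAC subrr add0r; apply: eq_bigl => g; rewrite eqbF_neg.
rewrite /gain_mean (partition_big (gproj phi) predT) //=; apply: eq_bigr => S _.
have -> : \prod_(t < n) bern p (S t)
    = \sum_(G | gproj phi G == S) gseq_prob pd pc G.
  under eq_bigr do rewrite -phi_bern.
  rewrite bigA_distr_big_dep; apply: eq_bigl => G.
  apply/familyP/eqP => [GS|<- t]; last by rewrite unfold_in ffunE.
  by apply/ffunP => t; rewrite ffunE; apply/eqP; have := GS t; rewrite unfold_in.
by rewrite big_distrl; apply: eq_bigr => G /eqP <-.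
Qed.

Lemma gain_mean_cst c : gain_mean (fun=> c) = c.
Proof.
(* A constant is a function of the mask of the impossible event. *)
rewrite (@gain_mean_proj (fun=> false) 0 (fun=> c)) ?mask_mean_cst //.
by rewrite big1 // => g _; rewrite mulr0.
Qed.

End GainMean.

(* [gd] and [gc] read off the direct and the cross gain seen by one receiver. *)
Definition receiver_law (pd pc : R) (gd gc : gain -> bool) :=
  forall b : bool -> bool -> R,
  \sum_g gain_prob pd pc g * b (gd g) (gc g) =
    pd * pc * b true true + pd * (1 - pc) * b true false
    + (1 - pd) * pc * b false true + (1 - pd) * (1 - pc) * b false false.

Lemma sum_gain (F : gain -> R) :
  \sum_g F g = \sum_x \sum_y \sum_z \sum_w F (x, y, z, w).
Proof.
by rewrite !pair_bigA /=; apply: eq_bigr => -[[[x y] z] w].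
Qed.

Lemma receiver_law1 pd pc : receiver_law pd pc g11 g21.
Proof.
move=> b; rewrite sum_gain !big_bool /gain_prob /g11 /g12 /g21 /g22 /bern /=; ring.
Qed.

Lemma receiver_law2 pd pc : receiver_law pd pc g22 g12.
Proof.
move=> b; rewrite sum_gain !big_bool /gain_prob /g11 /g12 /g21 /g22 /bern /=; ring.
Qed.

Section Receiver.
Variables (pd pc : R) (gd gc : gain -> bool).
Hypotheses (pd01 : 0 <= pd <= 1) (pc01 : 0 <= pc <= 1).
Hypothesis law : receiver_law pd pc gd gc.
Variables (n M M' : nat).
Variables (X : 'I_M -> bseq n) (X' : 'I_M' -> bseq n).
Variable dec : bseq n -> bseq n -> bseq n -> 'I_M.
Hypotheses (M_gt0 : (0 < M)%nat) (M'_gt0 : (0 < M')%nat).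

(** Written for a generic receiver, so that [err1] and [err2] are both instances, with the users
    exchanged. *)
Definition receiver_err : R :=
  \sum_(w : 'I_M) \sum_(w' : 'I_M') \sum_(G : {ffun 'I_n -> gain})
     (INR M * INR M')^-1 * gseq_prob pd pc G *
     Defs.ind (dec (receive (gproj gd G) (gproj gc G) (X w) (X' w'))
              (gproj gd G) (gproj gc G) != w).

(** The bounds at fixed gains are affine in the error probability, hence can be averaged. Every mask
    in them is a boolean function of the two gains seen by the receiver, and its parameter follows
    from [law]. *)
Lemma receiver_user_bound :
  user_bound pd pc (n%:R * ln 2%:R) (fun p => mask_mean p (masked_entropy X))
    (fun p => mask_mean p (masked_entropy X'))
    ((1 - receiver_err) * ln M%:R - 1).
Proof.
pose d G y := dec y (gproj gd G) (gproj gc G).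
pose Pe G : R := #|[pred w : 'I_M * 'I_M' |
   d G (receive (gproj gd G) (gproj gc G) (X w.1) (X' w.2)) != w.1]|%:R
   / #|{: 'I_M * 'I_M'}|%:R.
have prob1 : \sum_g gain_prob pd pc g = 1.
  have := law (fun _ _ => 1); under eq_bigr do rewrite mulr1.
  by move=> ->; ring.
have errE : receiver_err = gain_mean pd pc Pe.
  rewrite /receiver_err /gain_mean pair_bigA exchange_big /=; apply: eq_bigr => G _.
  rewrite /Pe -sum1_card natr_sum big_distrl big_distrr [RHS]big_mkcond.
  apply: eq_bigr => -[w w'] _.
  rewrite inE card_prod !card_ord natrM !INRE /Defs.ind /d /=.
  by case: eqP => _ /=; rewrite ?mulr0 // mulr1 mul1r mulrC.
have rateE : (1 - receiver_err) * ln M%:R - 1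
    = gain_mean pd pc (fun G => (1 - Pe G) * ln M%:R - 1).
  transitivity (gain_mean pd pc (fun G => (ln M%:R - 1) + - ln M%:R * Pe G)).
    by rewrite gain_meanD gain_meanZ gain_mean_cst // errE; ring.
  by apply: eq_bigr => G _; congr (_ * _); ring.
have W0 : (0 < #|'I_M|)%nat by rewrite card_ord.
have W'0 : (0 < #|'I_M'|)%nat by rewrite card_ord.
have law_proj (b : bool -> bool -> bool) p h :
    pd * pc * (b true true)%:R + pd * (1 - pc) * (b true false)%:R
    + (1 - pd) * pc * (b false true)%:R + (1 - pd) * (1 - pc) * (b false false)%:R = p ->
    mask_mean p h = gain_mean pd pc (fun G : {ffun 'I_n -> gain} =>
                      h (gproj (fun g => b (gd g) (gc g)) G)).
  move=> bp; symmetry; apply: (gain_mean_proj prob1).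
  exact: etrans (law (fun x y => (b x y)%:R)) bp.
rewrite /user_bound rateE.
rewrite (law_proj (fun x _ => x) pd) /=; last by ring.
rewrite (law_proj (fun _ y => y) pc) /=; last by ring.
rewrite (law_proj (fun x y => x && ~~ y) (pd * (1 - pc))) /=; last by ring.
rewrite (law_proj (fun x y => y && ~~ x) (pc * (1 - pd))) /=; last by ring.
have -> : n%:R * ln 2%:R * (pd * pc) = gain_mean pd pc (fun G : {ffun 'I_n -> gain} =>
    ln 2%:R * bcount (gproj (fun g => gd g && gc g) G)).
  rewrite gain_meanZ -(law_proj andb (pd * pc)) ?mask_mean_count /=; last by ring.
  ring.
rewrite -!gain_meanD; split; apply: gain_mean_le => // G.
  have := rate_receive_le_direct X X' (gproj gd G) (gproj gc G) W0 W'0 (d G).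
  by rewrite card_ord.
have := rate_receive_le_split X X' (gproj gd G) (gproj gc G) W0 W'0 (d G).
rewrite card_ord.
have -> : bdiff (gproj gd G) (gproj gc G) = gproj (fun g => gd g && ~~ gc g) G.
  by apply/ffunP => t; rewrite !ffunE.
have -> : bdiff (gproj gc G) (gproj gd G) = gproj (fun g => gc g && ~~ gd g) G.
  by apply/ffunP => t; rewrite !ffunE.
have -> // : binter (gproj gd G) (gproj gc G) = gproj (fun g => gd g && gc g) G.
by apply/ffunP => t; rewrite !ffunE.
Qed.

End Receiver.

(* One profile per transmitter: each user's desired profile is the other user's
   interfering one. *)
Definition paired_bounds pd pc N r1 r2 :=
  exists f1 f2, [/\ concave_profile N f1, concave_profile N f2,
    user_bound pd pc N f1 f2 r1 & user_bound pd pc N f2 f1 r2].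

Lemma code_bounds pd pc n M1 M2 (C : code n M1 M2) :
  0 <= pd <= 1 -> 0 <= pc <= 1 -> (0 < M1)%nat -> (0 < M2)%nat ->
  paired_bounds pd pc (n%:R * ln 2%:R)
    ((1 - err1 pd pc C) * ln M1%:R - 1) ((1 - err2 pd pc C) * ln M2%:R - 1).
Proof.
move=> pd01 pc01 M1_gt0 M2_gt0.
exists (fun p => mask_mean p (masked_entropy (enc1 C))).
exists (fun p => mask_mean p (masked_entropy (enc2 C))).
have e1 : err1 pd pc C = receiver_err pd pc g11 g21 (enc1 C) (enc2 C) (dec1 C).
  rewrite /err1 /receiver_err; apply: eq_bigr => w _; apply: eq_bigr => w' _.
  apply: eq_bigr => G _; congr (_ * Defs.ind (dec1 _ _ _ _ != _)).
  by apply/ffunP => t; rewrite !ffunE.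
have e2 : err2 pd pc C = receiver_err pd pc g22 g12 (enc2 C) (enc1 C) (dec2 C).
  rewrite /err2 /receiver_err exchange_big; apply: eq_bigr => w _; apply: eq_bigr => w' _.
  apply: eq_bigr => G _; rewrite [INR M1 * _]mulrC.
  congr (_ * Defs.ind (dec2 _ _ _ _ != _)).
  by apply/ffunP => t; rewrite !ffunE.
split; try by apply: masked_entropy_profile; rewrite card_ord.
- rewrite e1; apply: receiver_user_bound => //; exact: receiver_law1.
- rewrite e2; apply: receiver_user_bound => //; exact: receiver_law2.
Qed.

(** * From code bounds to the capacity region *)

Lemma ln_msg_size n (a : R) M : msg_size n a M ->
  (0 < M)%nat /\ n%:R * a * ln 2%:R <= ln M%:R.
Proof.
case/andP=> _; rewrite !INRE => le_M.
have exp_gt0 : 0 < Rpower 2%:R (n%:R * a) by apply/RltP/exp_pos.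
split; first by rewrite -(ltr0n R); apply: lt_le_trans le_M.
by have := ler_ln exp_gt0 le_M; rewrite ln_Rpower.
Qed.

(** If the bound failed by [del], decoding errors would cost at most half of the excess, while the
    other half grows linearly with [n] and overtakes the constant [c1 + c2] lost in Fano's
    inequality. *)
Lemma achievable_half_plane pd pc c1 c2 B a b :
  0 <= pd <= 1 -> 0 <= pc <= 1 -> 0 <= c1 -> 0 <= c2 ->
  (forall N r1 r2, paired_bounds pd pc N r1 r2 -> c1 * r1 + c2 * r2 <= N * B) ->
  achievable pd pc a b -> c1 * a + c2 * b <= B.
Proof.
move=> pd01 pc01 c1_ge0 c2_ge0 bounds [a_ge0 [b_ge0 [M1 [M2 [sizes [codes err0]]]]]].
rewrite leNgt; apply/negP => ltB.
pose K := c1 * a + c2 * b; pose del := K - B.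
have K_ge0 : 0 <= K by rewrite addr_ge0 ?mulr_ge0.
have del_gt0 : 0 < del by rewrite subr_gt0.
(* Ensures [eps * K <= del / 2]; adding [del] keeps the denominator positive when [K = 0]. *)
pose eps := del / (2%:R * (K + del)).
have Kdel_gt0 : 0 < 2%:R * (K + del) by lra.
have eps_gt0 : 0 < eps by rewrite divr_gt0.
have eps_le1 : eps <= 1 by rewrite ler_pdivrMr //; lra.
have epsK : eps * K <= del / 2%:R.
  have := divfK (lt0r_neq0 Kdel_gt0) del; rewrite -/eps => epsE.
  have : 0 <= eps * del by rewrite mulr_ge0 // ltW.
  lra.
have [n0 errs] := err0 eps eps_gt0.
have L_gt0 := ln2_gt0.
have Ld_gt0 : 0 < ln 2%:R * (del / 2%:R) by rewrite mulr_gt0 ?divr_gt0.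
pose n := maxn n0 (Num.bound ((c1 + c2) / (ln 2%:R * (del / 2%:R)))).
have n_big : c1 + c2 < n%:R * (ln 2%:R * (del / 2%:R)).
  rewrite -ltr_pdivrMr //; apply: lt_le_trans (archi_boundP _) _.
    by rewrite divr_ge0 ?addr_ge0 // ltW.
  by rewrite ler_nat leq_maxr.
have [e1 e2] := errs n (leq_maxl _ _).
have [/ln_msg_size[M1_gt0 lnM1] /ln_msg_size[M2_gt0 lnM2]] := sizes n.
have := bounds _ _ _ (code_bounds (codes n) pd01 pc01 M1_gt0 M2_gt0).
have rate_ge c e lnM x : 0 <= c -> 0 <= x -> e <= eps -> n%:R * x * ln 2%:R <= lnM ->
    c * ((1 - eps) * (n%:R * x * ln 2%:R) - 1) <= c * ((1 - e) * lnM - 1).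
  move=> c0 x0 ee lnMx; apply: ler_wpM2l => //; rewrite lerD2r.
  have nx0 : 0 <= n%:R * x * ln 2%:R by rewrite !mulr_ge0 ?ler0n // ltW.
  by apply: ler_pM => //; lra.
have := rate_ge _ _ _ _ c1_ge0 a_ge0 e1 lnM1.
have := rate_ge _ _ _ _ c2_ge0 b_ge0 e2 lnM2.
have nL_ge0 : 0 <= n%:R * ln 2%:R by rewrite mulr_ge0 ?ler0n // ltW.
have := ler_wpM2l nL_ge0 epsK.
move: n_big; rewrite /del /K; lra.
Qed.

Lemma capacity_half_plane pd pc c1 c2 B R1 R2 :
  0 <= pd <= 1 -> 0 <= pc <= 1 -> 0 <= c1 -> 0 <= c2 ->
  (forall N r1 r2, paired_bounds pd pc N r1 r2 -> c1 * r1 + c2 * r2 <= N * B) ->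
  capacity_region pd pc R1 R2 -> c1 * R1 + c2 * R2 <= B.
Proof.
move=> pd01 pc01 c1_ge0 c2_ge0 bounds cap.
rewrite leNgt; apply/negP; rewrite -subr_gt0; set del := _ - B => del_gt0.
have c_gt0 : 0 < c1 + c2 + 1 by lra.
(* The added 1 keeps the denominator positive and makes [(c1 + c2) * eps] strictly less than
   [del]. *)
pose eps := del / (c1 + c2 + 1).
have eps_gt0 : 0 < eps by rewrite divr_gt0.
have epsE : eps * (c1 + c2 + 1) = del by rewrite divfK ?gt_eqF.
clearbody eps.
have [a [b [ach]]] := cap eps eps_gt0.
have leB := achievable_half_plane pd01 pc01 c1_ge0 c2_ge0 bounds ach.
rewrite !RabsE !RminusE !ltr_norml => -[/andP[aR _] /andP[bR _]].
have {}aR : R1 <= a + eps by lra.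
have {}bR : R2 <= b + eps by lra.
have := ler_wpM2l c1_ge0 aR; have := ler_wpM2l c2_ge0 bR.
move: epsE; rewrite /del; lra.
Qed.

Lemma capacity_ge0 pd pc R1 R2 :
  capacity_region pd pc R1 R2 -> 0 <= R1 /\ 0 <= R2.
Proof.
move=> cap; split; rewrite leNgt; apply/negP => neg.
(* Any point within [- R1] of a negative [R1] is itself negative. *)
- have [|a [b [[a0 _] [aR _]]]] := cap (- R1); first by rewrite oppr_gt0.
  by move: aR; rewrite RabsE RminusE ltr_norml; lra.
- have [|a [b [[_ [b0 _]] [_ bR]]]] := cap (- R2); first by rewrite oppr_gt0.
  by move: bR; rewrite RabsE RminusE ltr_norml; lra.
Qed.

Lemma paired_bounds_sym pd pc N r1 r2 :
  paired_bounds pd pc N r1 r2 -> paired_bounds pd pc N r2 r1.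
Proof. by case=> f1 [f2 [? ? ? ?]]; exists f2, f1. Qed.

Lemma capacity_half_plane_sym pd pc c1 c2 B R1 R2 :
  0 <= pd <= 1 -> 0 <= pc <= 1 -> 0 <= c1 -> 0 <= c2 ->
  (forall N r1 r2, paired_bounds pd pc N r1 r2 -> c1 * r1 + c2 * r2 <= N * B) ->
  capacity_region pd pc R1 R2 -> c1 * R1 + c2 * R2 <= B /\ c1 * R2 + c2 * R1 <= B.
Proof.
move=> pd01 pc01 c1_ge0 c2_ge0 bounds cap; split.
- exact: capacity_half_plane cap.
- rewrite addrC; apply: capacity_half_plane cap => // N r1 r2.
  by move=> /paired_bounds_sym/bounds; rewrite addrC.
Qed.

Theorem theorem2 (pd pc : R) :
  (0 <= pd <= 1)%R -> (0 <= pc <= 1)%R ->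
  forall R1 R2 : R, capacity_region pd pc R1 R2 -> outer_bound pd pc R1 R2.
Proof.
case=> /RleP pd_ge0 /RleP pd_le1 [/RleP pc_ge0 /RleP pc_le1] R1 R2 cap.
rewrite R0E in pd_ge0 pc_ge0; rewrite R1E in pd_le1 pc_le1.
have pd01 : 0 <= pd <= 1 by rewrite pd_ge0.
have pc01 : 0 <= pc <= 1 by rewrite pc_ge0.
have [R1_ge0 R2_ge0] := capacity_ge0 cap.
have direct : R1 <= pd /\ R2 <= pd.
  have [] := @capacity_half_plane_sym pd pc 1 0 pd R1 R2 => //; last by lra.
  by move=> N r1 r2 [f1 [f2 [f1P f2P u1 u2]]]; have := direct_bound pd01 f1P u1; lra.
have rates : (0 <= R1 <= pd) /\ (0 <= R2 <= pd).
  by case: direct => -> ->; rewrite R1_ge0 R2_ge0.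
case: rates => rate1 rate2.
have pd1_gt0 : 0 < 1 + pd by lra.
split; [|split].
- rewrite ler_pdivlMr // => weak; split=> //; split=> // pc_gt0.
  have pd_gt0 : 0 < pd.
    by rewrite lt_neqAle pd_ge0 andbT; apply/eqP => pd0; rewrite -pd0 in weak; lra.
  have pdc_gt0 : 0 < pd * pc by rewrite mulr_gt0.
  (* The threshold [pd / (1 + pd)] on [pc] marks exactly where [pc] and [pd * (1 - pc)] change
     order. *)
  have cd : pc <= pd * (1 - pc) by lra.
  set beta := (pd - pc) / (pd * pc).
  have betaE : pd - pc = beta * (pd * pc) by rewrite divfK ?gt_eqF.
  have beta_ge0 : 0 <= beta by rewrite divr_ge0 ?(ltW pdc_gt0) //; move: pdc_gt0; lra.
  have [] := @capacity_half_plane_sym pd pc 1 beta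
    (beta * pd + pc - pd * pc) R1 R2 => //; last by rewrite !mul1r.
  move=> N r1 r2 [f1 [f2 [f1P f2P u1 u2]]].
  (* Scaling by [pd * pc] clears the denominator of [beta]. *)
  rewrite -(ler_pM2l pdc_gt0).
  have := weak_bound pd01 pc01 f1P f2P u1 u2 cd; rewrite betaE; lra.
- rewrite ler_pdivrMr // => /andP[moderate cd]; split=> //; split=> //; split.
    have [] := @capacity_half_plane_sym pd pc 1 1 (2 * pc) R1 R2 => //;
    last by rewrite !mul1r.
    move=> N r1 r2 [f1 [f2 [f1P f2P u1 u2]]].
    have dc : pd * (1 - pc) <= pc by lra.
    by have := moderate_sum_bound pd01 pc01 f1P f2P u1 u2 dc; rewrite !mul1r.
  move=> pc_gt0; set k := pd / pc.
  have kE : pd = k * pc by rewrite divfK ?gt_eqF.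
  have k_ge0 : 0 <= k by rewrite divr_ge0.
  have [] := @capacity_half_plane_sym pd pc 1 k
    (k * (pd + pc - pd * pc)) R1 R2 => //; last by rewrite !mul1r.
  move=> N r1 r2 [f1 [f2 [f1P f2P u1 u2]]].
  rewrite -(ler_pM2l pc_gt0).
  have -> : pc * (1 * r1 + k * r2) = pc * r1 + k * pc * r2 by ring.
  have -> : pc * (N * (k * (pd + pc - pd * pc)))
    = N * (k * pc * (pd + pc - pd * pc)) by ring.
  rewrite -kE; exact: moderate_bound f1P f2P u1 u2 cd.
- move=> dc; split=> //; split=> //.
  have [] := @capacity_half_plane_sym pd pc 1 1 (pd + pc - pd * pc) R1 R2 => //;
    last by rewrite !mul1r.
  move=> N r1 r2 [f1 [f2 [f1P f2P u1 u2]]].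
  by have := strong_sum_bound pd01 pc01 f1P f2P u1 u2 dc; rewrite !mul1r.
Qed.
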